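(* Let $(B,\psi)$ be a finite quantum space with $\delta$-form $\psi$, and let $(B^{\otimes\mathbb{N}},\alpha,\mathcal{L})$ be the Exel system given by $\alpha(f)=1_B\otimes f$ for $f\in B^{\otimes\mathbb{N}}$, and $\mathcal{L}(f_1\otimes g)=\psi(f_1)g$ for $f_1\in B$, $g\in B^{\otimes\mathbb{N}}$. Then the Exel crossed product $B^{\otimes\mathbb{N}}\rtimes_{\alpha,\mathcal{L}}\mathbb{N}$ is isomorphic to the Cuntz algebra $\mathcal{O}_n$, where $n=\dim B$.
   Context: A finite quantum space $(B,\psi)$ is a finite-dimensional C*-algebra $B$ with a faithful state $\psi$ that is a $\delta$-form, $\delta>0$: if $m\colon B\otimes B\to B$ is multiplication and $m^*\colon B\to B\otimes B$ is its adjoint with respect to the inner products induced by $\psi$ and $\psi\otimes\psi$ (with $\langle x,y\rangle_\psi=\psi(x^*y)$), then $mm^*=\delta^2\,\mathrm{id}_B$. $B^{\otimes\mathbb{N}}$ is the infinite C*-tensor product of copies of $B$ (inductive limit of $B^{\otimes k}$ under $x\mapsto x\otimes1_B$), and $B\otimes B^{\otimes\mathbb{N}}$ is identified with $B^{\otimes\mathbb{N}}$ by placing the first tensor factor first. Let $\mathcal{C}$ be a unital C*-algebra and $\alpha\colon\mathcal{C}\to\mathcal{C}$ a $*$-endomorphism. A transfer operator is a positive linear map $\mathcal{L}\colon\mathcal{C}\to\mathcal{C}$ with $\mathcal{L}(\alpha(f)g)=f\mathcal{L}(g)$ for all $f,g\in\mathcal{C}$; then $(\mathcal{C},\alpha,\mathcal{L})$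 is an Exel system. The Toeplitz algebra $\mathcal{T}(\mathcal{C},\alpha,\mathcal{L})$ is the universal (unital) C*-algebra generated by a copy of $\mathcal{C}$ and an element $S$ with $Sf=\alpha(f)S$ and $\mathcal{L}(f)=S^*fS$ for all $f\in\mathcal{C}$. A redundancy is a pair $(f,k)$ with $f\in\mathcal{C}$, $k\in\overline{\mathcal{C}SS^*\mathcal{C}}$ (closed linear span) and $fgS=kgS$ for all $g\in\mathcal{C}$. The Exel crossed product $\mathcal{C}\rtimes_{\alpha,\mathcal{L}}\mathbb{N}$ is the quotient of $\mathcal{T}(\mathcal{C},\alpha,\mathcal{L})$ by the closed two-sided ideal generated by the differences $f-k$ of redundancies $(f,k)$. The Cuntz algebra $\mathcal{O}_n$ is the universal unital C*-algebra generated by $n$ isometries whose range projections sum to $1$ (for $n=1$ this is $C(\mathbb{T})$). *)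

(* Defs.v *)
From HB Require Import structures.
From mathcomp Require Import all_boot all_order all_algebra.
From mathcomp Require Import complex.
From mathcomp Require Import boolp classical_sets reals topology normedtype.

Set Implicit Arguments.
Unset Strict Implicit.
Unset Printing Implicit Defensive.

Import Order.TTheory GRing.Theory Num.Theory.
Import numFieldNormedType.Exports.

Local Open Scope classical_set_scope.
Local Open Scope ring_scope.

(* Unital C*-algebras over the complex numbers [R[i]].  The norm takes its
   values in [R[i]]; they are real and nonnegative, since [0 <= z] in [R[i]]
   means that [z] is real and nonnegative.  The zero algebra is allowed.  The
   product is an operation of the mixin, and the ring structure is derived from
   it below, because Hierarchy Builder has no common substructure of rings and
   normed modules besides numeric domains. *)
HB.mixin Record isCStarAlgebra (R : realType) A
    of CompleteNormedModule R[i] A := {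
  cstar_mul : A -> A -> A ;
  cstar_one : A ;
  star : A -> A ;
  cstar_mulA : associative cstar_mul ;
  cstar_mul1l : left_id cstar_one cstar_mul ;
  cstar_mul1r : right_id cstar_one cstar_mul ;
  cstar_mulDl : left_distributive cstar_mul +%R ;
  cstar_mulDr : right_distributive cstar_mul +%R ;
  cstar_scaleAl_subproof : forall (a : R[i]) (x y : A),
    a *: cstar_mul x y = cstar_mul (a *: x) y ;
  cstar_scaleAr_subproof : forall (a : R[i]) (x y : A),
    a *: cstar_mul x y = cstar_mul x (a *: y) ;
  starD : forall x y : A, star (x + y) = star x + star y ;
  starZ : forall (a : R[i]) (x : A), star (a *: x) = a^* *: star x ;
  starM_subproof : forall x y : A,
    star (cstar_mul x y) = cstar_mul (star y) (star x) ;
  starK : forall x : A, star (star x) = x ;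
  cstar_normM_subproof : forall x y : A, `|cstar_mul x y| <= `|x| * `|y| ;
  cstar_norm_subproof : forall x : A, `|cstar_mul (star x) x| = `|x| ^+ 2
}.

#[short(type="cstarType")]
HB.structure Definition CStarAlgebra (R : realType) :=
  {A of CompleteNormedModule R[i] A & isCStarAlgebra R A}.

#[short(type="fdCstarType")]
HB.structure Definition FinDimCStarAlgebra (R : realType) :=
  {A of CStarAlgebra R A & Vector R[i] A}.

#[non_forgetful_inheritance]
HB.instance Definition _ (R : realType) (A : cstarType R) :=
  GRing.Zmodule_isPzRing.Build A (@cstar_mulA R A) (@cstar_mul1l R A)
    (@cstar_mul1r R A) (@cstar_mulDl R A) (@cstar_mulDr R A).

Section CStarTheory.
Context {R : realType} {A : cstarType R}.
Implicit Types (a : R[i]) (x y : A).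

Lemma cstar_scaleAl a x y : a *: (x * y) = (a *: x) * y.
Proof. exact: cstar_scaleAl_subproof. Qed.

Lemma cstar_scaleAr a x y : a *: (x * y) = x * (a *: y).
Proof. exact: cstar_scaleAr_subproof. Qed.

Lemma starM x y : star (x * y) = star y * star x.
Proof. exact: starM_subproof. Qed.

Lemma cstar_normM x y : `|x * y| <= `|x| * `|y|.
Proof. exact: cstar_normM_subproof. Qed.

Lemma cstar_norm x : `|star x * x| = `|x| ^+ 2.
Proof. exact: cstar_norm_subproof. Qed.

End CStarTheory.

Section Morphisms.
Context {R : realType}.
Implicit Types X Y : cstarType R.

Definition starhom X Y (f : X -> Y) : Prop :=
  [/\ linear f, {morph f : x y / x * y} & {morph f : x / star x}].

Definition unital_starhom X Y (f : X -> Y) : Prop := starhom f /\ f 1 = 1.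

Definition star_isomorphic X Y : Prop :=
  exists f : X -> Y, unital_starhom f /\ bijective f.

Definition positive X (x : X) : Prop := exists y, x = star y * y.

Definition positive_map X Y (f : X -> Y) : Prop :=
  forall x, positive x -> positive (f x).

End Morphisms.

Section ClosedSpans.
Context {R : realType} {X : cstarType R}.

Definition closed_subspace (M : set X) : Prop :=
  [/\ closed M, M 0 & forall (a : R[i]) x y, M x -> M y -> M (a *: x + y)].

Definition closed_span (G : set X) : set X := smallest closed_subspace G.

Definition closed_ideal (I : set X) : Prop :=
  [/\ closed I, I 0, forall x y, I x -> I y -> I (x + y)
    & forall a x, I x -> I (a * x) /\ I (x * a)].

Definition closed_ideal_gen (G : set X) : set X := smallest closed_ideal G.

End ClosedSpans.

Section Tensor.
Context {R : realType}.

(* The C*-algebra [Z], with elementary tensors [t x y], is the tensor product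
   of [X] and [Y]: its underlying *-algebra is the algebraic tensor product,
   given by its universal property among vector spaces.  When [X] or [Y] is
   finite-dimensional, the only case used below, the algebraic tensor product
   is already complete for its unique C*-norm, so that this is the C*-tensor
   product. *)
Definition tensor_product (X Y Z : cstarType R) (t : X -> Y -> Z) : Prop :=
  [/\ (forall y, linear (t^~ y)) /\ (forall x, linear (t x)),
      (forall x x' y y', t x y * t x' y' = t (x * x') (y * y')),
      (forall x y, star (t x y) = t (star x) (star y))
    & forall (V : lmodType R[i]) (f : X -> Y -> V),
        (forall y, linear (f^~ y)) -> (forall x, linear (f x)) ->
        exists! g : Z -> V, linear g /\ forall x y, g (t x y) = f x y].

Definition inductive_limit (P : nat -> cstarType R)
    (c : forall k, P k -> P k.+1) (A : cstarType R) (j : forall k, P k -> A)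
    : Prop :=
  [/\ (forall k, unital_starhom (j k)),
      (forall k x, j k.+1 (c k x) = j k x)
    & forall (D : cstarType R) (phi : forall k, P k -> D),
        (forall k, unital_starhom (phi k)) ->
        (forall k x, phi k.+1 (c k x) = phi k x) ->
        exists! theta : A -> D,
          unital_starhom theta /\ forall k x, theta (j k x) = phi k x].

(* [b \otimes x 0 \otimes x 1 \otimes ...] *)
Definition prepend (B : Type) (b : B) (x : nat -> B) : nat -> B :=
  fun n => if n is m.+1 then x m else b.

(* [x 0 \otimes ... \otimes x k], where [P k] is the (k+1)-st tensor power. *)
Fixpoint elementary (B : cstarType R) (P : nat -> cstarType R)
    (u : B -> P 0%N) (t : forall k, P k -> B -> P k.+1) (x : nat -> B) (k : nat)
    : P k :=
  if k is m.+1 then t m (elementary u t x m) (x m.+1) else u (x 0%N).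

(* A model of the infinite tensor power of [B], together with the
   identification [itp_first] of [B \otimes B^{\otimes N}] with
   [B^{\otimes N}]: [itp_first b f] is [b \otimes f].  The algebra [itp_pow k]
   is [B^{\otimes (k+1)}]. *)
Record infinite_tensor_power (B : cstarType R) := InfiniteTensorPower {
  itp_algebra :> cstarType R ;
  itp_pow : nat -> cstarType R ;
  itp_pow0 : B -> itp_pow 0%N ;
  itp_tensor : forall k, itp_pow k -> B -> itp_pow k.+1 ;
  itp_inj : forall k, itp_pow k -> itp_algebra ;
  itp_first : B -> itp_algebra -> itp_algebra ;
  itp_pow0P : unital_starhom itp_pow0 /\ bijective itp_pow0 ;
  itp_tensorP : forall k, tensor_product (@itp_tensor k) ;
  itp_limitP : inductive_limit (fun k (x : itp_pow k) => itp_tensor x 1) itp_inj ;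
  itp_firstP : tensor_product itp_first ;
  itp_first_elementary : forall b x k,
    itp_first b (itp_inj (elementary itp_pow0 itp_tensor x k)) =
    itp_inj (elementary itp_pow0 itp_tensor (prepend b x) k.+1)
}.

End Tensor.

Section QuantumSpace.
Context {R : realType}.

Definition faithful_state (B : cstarType R) (psi : {scalar B}) : Prop :=
  [/\ forall x : B, 0 <= psi (star x * x), psi 1 = 1
    & forall x : B, psi (star x * x) = 0 -> x = 0].

Definition inner (X : cstarType R) (phi : X -> R[i]) (x y : X) : R[i] :=
  phi (star x * y).

Definition delta_form (B : cstarType R) (psi : {scalar B}) (delta : R) : Prop :=
  exists (B2 : cstarType R) (t : B -> B -> B2) (psi2 : {scalar B2})
         (m : {linear B2 -> B}) (mstar : {linear B -> B2}),
    [/\ tensor_product t,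
        forall x y, psi2 (t x y) = psi x * psi y,
        forall x y, m (t x y) = x * y,
        forall x z, inner psi2 (mstar x) z = inner psi x (m z)
      & forall x, m (mstar x) = delta%:C%C ^+ 2 *: x].

End QuantumSpace.

Section Exel.
Context {R : realType} {C : cstarType R}.
Implicit Types (alpha L : C -> C) (T E : cstarType R).

Definition transfer_operator alpha L : Prop :=
  [/\ linear L, positive_map L & forall f g, L (alpha f * g) = f * L g].

Definition exel_system alpha L : Prop :=
  starhom alpha /\ transfer_operator alpha L.

Definition toeplitz_relations alpha L T (i : C -> T) (S : T) : Prop :=
  [/\ unital_starhom i, forall f, S * i f = i (alpha f) * S
    & forall f, i (L f) = star S * i f * S].

Definition toeplitz_algebra alpha L T (i : C -> T) (S : T) : Prop :=
  toeplitz_relations alpha L i S /\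
  forall (D : cstarType R) (phi : C -> D) (s : D),
    toeplitz_relations alpha L phi s ->
    exists! theta : T -> D,
      [/\ unital_starhom theta, forall f, theta (i f) = phi f & theta S = s].

Definition redundancy T (i : C -> T) (S : T) (f : C) (k : T) : Prop :=
  closed_span [set x | exists a b, x = i a * S * star S * i b] k /\
  forall g, i f * i g * S = k * i g * S.

(* [E] is the crossed product: the quotient of the Toeplitz algebra by the
   closed ideal generated by the differences of redundancies. *)
Definition exel_crossed_product alpha L E : Prop :=
  exists (T : cstarType R) (i : C -> T) (S : T) (q : T -> E),
    [/\ toeplitz_algebra alpha L i S,
        unital_starhom q,
        forall e, exists x, q x = e
      & forall x, q x = 0 <->
          closed_ideal_gen
            [set y | exists f k, redundancy i S f k /\ y = i f - k] x].

End Exel.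

Section Cuntz.
Context {R : realType}.

Definition cuntz_relations (n : nat) (A : cstarType R) (s : 'I_n -> A) : Prop :=
  (forall i, star (s i) * s i = 1) /\ \sum_(i < n) s i * star (s i) = 1.

Definition cuntz_algebra (n : nat) (O : cstarType R) : Prop :=
  exists s : 'I_n -> O, cuntz_relations s /\
    forall (D : cstarType R) (r : 'I_n -> D), cuntz_relations r ->
      exists! theta : O -> D,
        unital_starhom theta /\ forall i, theta (s i) = r i.

End Cuntz.

(* Main.v *)
Require Import Defs.
From mathcomp Require Import all_boot all_order all_algebra.
From mathcomp Require Import complex.
From mathcomp Require Import boolp classical_sets reals topology normedtype.
From mathcomp Require Import ring.

Set Implicit Arguments.
Unset Strict Implicit.
Unset Printing Implicit Defensive.

Import Order.TTheory GRing.Theory Num.Theory.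
Import numFieldNormedType.Exports.

Local Open Scope classical_set_scope.
Local Open Scope ring_scope.

(* For an orthonormal basis [e] of [L^2(B, psi)], the elements [(e_i \otimes 1) S]
   of the Toeplitz algebra are isometries with orthogonal ranges, and the sum [k]
   of their range projections makes [(1, k)] a redundancy; hence they satisfy the
   Cuntz relations in the crossed product.  Conversely, Cuntz generators [s_i]
   extend linearly to creation operators [V x] ([x] in [B]).  Left multiplication
   [pi b = \sum_j V (b e_j) (V e_j)^*] and the canonical endomorphism
   [rho y = \sum_j V e_j y (V e_j)^*] have commuting ranges, so that
   [phi (b \otimes f) = pi b * rho (phi f)] defines a representation of
   [B^{\otimes N}], and [(phi, V 1)] satisfies the Toeplitz relations.  A redundancy
   [(f, k)] gives [f s_i = k s_i] for all [i], hence [f = k].  The two maps are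
   inverse to each other on generators.

   Two facts on C*-algebras are needed, and they are proved without spectral
   theory.  The kernel of a unital *-homomorphism is closed: a small self-adjoint
   [x] is the real part of the unitary [x + i sqrt (1 - x^2)], so that its image
   has norm at most 1.  Projections with sum 1 are orthogonal: otherwise a nonzero
   corner [y] of one of them satisfies [|p + z y| <= 1] for four directions of
   the scalar [z], a condition which is stable under [y |-> 2 y]. *)

(** * Adjoints and norms of projections *)

Section Basics.
Context {R : realType} {A : cstarType R}.
Implicit Types (x y z : A) (a : R[i]).

Lemma star0 : star (0 : A) = 0.
Proof. by apply: (@addrI _ (star (0 : A))); rewrite -starD !addr0. Qed.

Lemma starN x : star (- x) = - star x.
Proof. by apply: (@addrI _ (star x)); rewrite -starD !subrr star0. Qed.

Lemma starB x y : star (x - y) = star x - star y.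
Proof. by rewrite starD starN. Qed.

Lemma star_sum (I : finType) (F : I -> A) :
  star (\sum_i F i) = \sum_i star (F i).
Proof. by apply: (big_morph _ starD star0). Qed.

Lemma star1 : star (1 : A) = 1.
Proof. by rewrite -[LHS]mulr1 -{2}[1]starK -starM mulr1 starK. Qed.

Lemma norm_star x : `|star x| = `|x|.
Proof.
have le_norm y : `|y| <= `|star y|.
  have [->|y0] := eqVneq y 0; first by rewrite star0.
  by rewrite -(ler_pM2r (_ : 0 < `|y|)) ?normr_gt0// -expr2 -cstar_norm cstar_normM.
by apply/eqP; rewrite eq_le le_norm -{2}[x]starK le_norm.
Qed.

(** The C*-identity gives [|p| = |p|^2], so the norm is 0 or 1. The inequality also covers the zero
    algebra. *)
Lemma norm_proj_le1 (p : A) : star p = p -> p * p = p -> `|p| <= 1.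
Proof.
move=> sp pp; have := cstar_norm p; rewrite sp pp => /eqP.
rewrite expr2 -subr_eq0 -{1}[`|_|]mulr1 -mulrBr mulf_eq0 subr_eq0.
by move=> /orP[/eqP->|/eqP<-].
Qed.

Lemma norm1_le1 : `|1 : A| <= 1.
Proof. by apply: norm_proj_le1; [exact: star1|exact: mulr1]. Qed.

End Basics.

(** * Limits controlled by powers of 1/2 *)

Lemma half_exp_lt {R : realType} (e : R[i]) :
  0 < e -> exists n, 2^-1 ^+ n < e.
Proof.
case: e => a b; rewrite ltcE /= => /andP[/eqP -> a0].
have [n hn] : exists n : nat, a^-1 < n%:R.
  exists (Num.bound a^-1); rewrite -[a^-1]ger0_norm ?invr_ge0 ?ltW//.
  by rewrite archi_boundP// invr_ge0 ltW.
exists n; rewrite exprVn.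
have -> : (a +i* 0)%C = (a%:C)%C by [].
rewrite -[a in a%:C%C]invrK fmorphV/= ltf_pV2 ?posrE ?exprn_gt0 ?ltr0n//; last first.
  by rewrite ltcR invr_gt0.
have -> : 2 ^+ n = ((2 ^ n)%:R : R)%:C%C by rewrite rmorph_nat natrX.
by rewrite ltcR (lt_trans hn)// ltr_nat ltn_expl.
Qed.

Lemma geometric_cvg {R : realType} {A : completeNormedModType R[i]} (u : nat -> A) :
  (forall n, `|u n.+1 - u n| <= 2^-1 ^+ n) ->
  exists l : A, u @ \oo --> l.
Proof.
move=> hu.
have hd m k : `|u (m + k)%N - u m| <= 2 * 2^-1 ^+ m.
  (* The partial geometric sum, rather than its limit, is the bound that survives induction on
     [k]. *)
  suff: `|u (m + k)%N - u m| <= 2 * 2^-1 ^+ m - 2 * 2^-1 ^+ (m + k).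
    by move/le_trans; apply; rewrite gerBl mulr_ge0// exprn_ge0// invr_ge0.
  elim: k => [|k IH]; first by rewrite addn0 !subrr normr0.
  rewrite addnS -(subrKA (u (m + k)%N)) (le_trans (ler_normD _ _))//.
  rewrite (le_trans (lerD (hu _) IH))// exprS mulrA divff ?pnatr_eq0// mul1r.
  by rewrite addrC -addrA lerD2l mulr_natl mulr2n opprD subrK.
apply/cvg_ex; apply: cauchy_cvg; apply: cauchy_exP => e e0.
have [N hN] : exists N, 2^-1 ^+ N < e / 2 by apply: half_exp_lt; rewrite divr_gt0.
exists (u N); exists N => // m /= Nm.
rewrite -ball_normE /= distrC -(subnKC Nm) (le_lt_trans (hd _ _))//.
by rewrite mulrC -ltr_pdivlMr.
Qed.

(** Taking [e = |v| / (2 c)] would give [|v| <= |v| / 2]. This turns approximation arguments into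
    equalities. *)
Lemma small_eq0 {K : numFieldType} {V : normedZmodType K} (v : V) (c : K) :
  0 < c -> (forall e, 0 < e -> `|v| <= c * e) -> v = 0.
Proof.
move=> c0 hv; apply/eqP/negPn/negP => v0.
have := hv (`|v| / (c * 2)).
rewrite divr_gt0 ?mulr_gt0 ?normr_gt0// => /(_ isT).
rewrite [c * 2]mulrC invfM mulrCA [c * _]mulrCA divff ?gt_eqF// mulr1.
by rewrite ler_pdivlMr// ger_pMr ?normr_gt0// lern1.
Qed.

(** * The square root of [1 - x^2] by fixed-point iteration *)

Section SquareRoot.
Context {R : realType} {A : cstarType R}.
Implicit Types (x y z w : A).

Local Notation half := (2^-1 : R[i]).

(** Each iterate is a real polynomial in [x^2], so it inherits self-adjointness and commutation with
    [x]. *)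
Fixpoint sqrt_iter x n : A :=
  if n is m.+1 then half *: (x * x + sqrt_iter x m * sqrt_iter x m) else 0.

Lemma sqrt_iterS x n :
  sqrt_iter x n.+1 = half *: (x * x + sqrt_iter x n * sqrt_iter x n).
Proof. by []. Qed.

Lemma half_gt0 : 0 < half.
Proof. by rewrite invr_gt0. Qed.

Lemma norm_half : `|half| = half.
Proof. by rewrite ger0_norm// ltW// half_gt0. Qed.

Lemma half_lt1 : half <= 1.
Proof. by rewrite invf_le1// ler1n. Qed.

Lemma half2 : half + half = 1.
Proof. by rewrite [RHS]splitr mul1r. Qed.

(** The ball of radius 1/4 is stable because [(1/4 + 1/16) / 2 <= 1/4]. *)
Lemma norm_sqrt_iter x n : `|x| <= half -> `|sqrt_iter x n| <= half ^+ 2.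
Proof.
move=> hx; have hh : half ^+ 2 <= 1 by rewrite exprn_ile1 ?half_lt1// ltW ?half_gt0.
elim: n => [|n IH] /=; first by rewrite normr0 exprn_ge0// ltW// half_gt0.
rewrite normrZ norm_half [leRHS](_ : _ = half * (half ^+ 2 + half ^+ 2)); last first.
  by rewrite expr2 -mulrDr half2 mulr1.
rewrite ler_pM2l ?half_gt0// (le_trans (ler_normD _ _))// lerD//.
  by rewrite (le_trans (cstar_normM _ _))// expr2 ler_pM.
rewrite (le_trans (cstar_normM _ _))// (le_trans (ler_pM _ _ IH IH))//.
by rewrite ger_pMl// exprn_gt0// half_gt0.
Qed.

Lemma sqr_sub z w : z * z - w * w = z * (z - w) + (z - w) * w.
Proof. by rewrite mulrBr mulrBl addrA subrK. Qed.

Lemma norm_sqr_sub z w c : `|z| <= c -> `|w| <= c ->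
  `|z * z - w * w| <= (c + c) * `|z - w|.
Proof.
move=> hz hw; rewrite sqr_sub (le_trans (ler_normD _ _))// [leRHS]mulrDl lerD//.
  by rewrite (le_trans (cstar_normM _ _))// ler_wpM2r.
by rewrite (le_trans (cstar_normM _ _))// mulrC ler_wpM2r.
Qed.

(** On the ball of radius 1/2 squaring is 1-Lipschitz, so the iteration contracts distances by
    1/2. *)
Lemma sqrt_iter_cauchy x n : `|x| <= half ->
  `|sqrt_iter x n.+1 - sqrt_iter x n| <= half ^+ n.
Proof.
move=> hx; have hh : half ^+ 2 <= half by rewrite expr2 ger_pMl ?half_gt0 ?half_lt1.
elim: n => [|n IH].
  by rewrite subr0 (le_trans (norm_sqrt_iter 1 hx))// (le_trans hh)// half_lt1.
rewrite (sqrt_iterS x n.+1) [X in _ - X]sqrt_iterS -scalerBr opprD addrACA subrr add0r.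
rewrite normrZ norm_half exprS ler_pM2l ?half_gt0//.
have hw k : `|sqrt_iter x k| <= half := le_trans (norm_sqrt_iter k hx) hh.
rewrite (le_trans (norm_sqr_sub (hw _) (hw _)))//.
by rewrite half2 mul1r.
Qed.

Lemma star_sqrt_iter x n : star x = x -> star (sqrt_iter x n) = sqrt_iter x n.
Proof.
move=> sx; elim: n => [|n IH] /=; first exact: star0.
by rewrite starZ starD !starM IH sx geC0_conj// ltW// half_gt0.
Qed.

Lemma sqrt_iter_comm x n : sqrt_iter x n * x = x * sqrt_iter x n.
Proof.
elim: n => [|n IH] /=; first by rewrite mul0r mulr0.
rewrite -cstar_scaleAl -cstar_scaleAr mulrDl mulrDr mulrA.
by rewrite -[sqrt_iter x n * _ * x]mulrA IH mulrA IH mulrA.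
Qed.

(* [y] is [sqrt (1 - x^2)]: [1 - y] is the fixed point of [w |-> (x^2 + w^2)/2]. *)
Lemma sqrt_exists x : star x = x -> `|x| <= half ->
  exists y, [/\ star y = y, y * x = x * y & x * x + y * y = 1].
Proof.
move=> sx hx; have hh : half ^+ 2 <= half by rewrite expr2 ger_pMl ?half_gt0 ?half_lt1.
have hw n : `|sqrt_iter x n| <= half := le_trans (norm_sqrt_iter n hx) hh.
have [l hl] := geometric_cvg (fun n => sqrt_iter_cauchy n hx).
(* One index serves two consecutive iterates, since the fixed-point equation relates [n] to
   [n + 1]. *)
have near e : 0 < e -> exists n, `|l - sqrt_iter x n| <= e /\ `|l - sqrt_iter x n.+1| <= e.
  move=> e0; have /cvgrPdist_lt /(_ e e0) [N _ hN] := hl.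
  by exists N; split; apply/ltW; apply: hN => /=.
have sl : star l = l.
  apply/eqP; rewrite -subr_eq0; apply/eqP/(@small_eq0 _ _ _ 2) => // e /near[n [hn _]].
  rewrite -{1}[l](subrK (sqrt_iter x n)) starD star_sqrt_iter// -addrA.
  rewrite -[X in _ + X]opprB (le_trans (ler_normB _ _))// norm_star.
  by rewrite mulr_natl mulr2n; apply: lerD.
have cl : l * x = x * l.
  apply/eqP; rewrite -subr_eq0; apply/eqP/(@small_eq0 _ _ _ 1) => // e /near[n [hn _]].
  have -> : l * x - x * l = (l - sqrt_iter x n) * x - x * (l - sqrt_iter x n).
    by rewrite mulrBl mulrBr sqrt_iter_comm opprB addrA addrNK.
  rewrite (le_trans (ler_normB _ _))// mul1r -[e]mulr1 -half2 [leRHS]mulrDr; apply: lerD.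
    by rewrite (le_trans (cstar_normM _ _))// ler_pM.
  by rewrite (le_trans (cstar_normM _ _))// mulrC ler_pM.
have nl : `|l| <= 1.
  have [n [hn _]] := near _ half_gt0.
  by rewrite -[l](subrK (sqrt_iter x n)) -half2 (le_trans (ler_normD _ _))//; apply: lerD.
have fl : l + l = x * x + l * l.
  apply/eqP; rewrite -subr_eq0; apply/eqP/(@small_eq0 _ _ _ 4) => // e /near[n [hn hn1]].
  have e2 : sqrt_iter x n.+1 + sqrt_iter x n.+1 = x * x + sqrt_iter x n * sqrt_iter x n.
    by rewrite /= -scalerDl half2 scale1r.
  have -> : l + l - (x * x + l * l) = (l - sqrt_iter x n.+1) + (l - sqrt_iter x n.+1)
      - (l * l - sqrt_iter x n * sqrt_iter x n).
    rewrite addrACA -opprD e2 opprB !opprD -!addrA; congr (_ + (_ + (_ + _))).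
    by rewrite addKr.
  rewrite (le_trans (ler_normB _ _))// [4 * e](_ : _ = (e + e) + (1 + 1) * e); last first.
    by rewrite mulr_natl mulrDl !mul1r -!mulr2n -mulrnA.
  rewrite lerD//; first by rewrite (le_trans (ler_normD _ _))// lerD.
  rewrite (le_trans (norm_sqr_sub nl (le_trans (hw n) half_lt1)))//.
  by rewrite ler_wpM2l// addr_ge0.
exists (1 - l); split; first by rewrite starB star1 sl.
  by rewrite mulrBl mulrBr mul1r mulr1 cl.
have -> : x * x = l + l - l * l by rewrite fl addrK.
rewrite mulrBl mul1r mulrBr mulr1 opprB [l * l - l]addrC -(addrA 1) [- l + (- l + _)]addrA -opprD.
by rewrite [1 + _]addrA addrA addrAC addrNK addrC subrK.
Qed.

End SquareRoot.

(** * Linear maps given by a predicate *)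

Section LinearMaps.
Context {K : pzRingType} {U V : lmodType K} {f : U -> V}.
Hypothesis lf : linear f.

Lemma linear_add x y : f (x + y) = f x + f y.
Proof. by rewrite -[x]scale1r lf !scale1r. Qed.

Lemma linear0f : f 0 = 0.
Proof. by apply: (@addrI _ (f 0)); rewrite -linear_add !addr0. Qed.

Lemma linear_scale a x : f (a *: x) = a *: f x.
Proof. by rewrite -[a *: x]addr0 lf linear0f addr0. Qed.

Lemma linear_opp x : f (- x) = - f x.
Proof. by rewrite -scaleN1r linear_scale scaleN1r. Qed.

Lemma linear_sub x y : f (x - y) = f x - f y.
Proof. by rewrite linear_add linear_opp. Qed.

Lemma linear_bigsum (I : finType) (F : I -> U) : f (\sum_i F i) = \sum_i f (F i).
Proof. exact: (big_morph _ linear_add linear0f). Qed.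

End LinearMaps.

(** * Boundedness of unital *-homomorphisms *)

Section StarHom.
Context {R : realType}.
Implicit Types X Y Z : cstarType R.

Lemma unital_starhom_comp X Y Z (g : Y -> Z) (f : X -> Y) :
  unital_starhom g -> unital_starhom f -> unital_starhom (g \o f).
Proof.
move=> [[lg mg sg] g1] [[lf mf sf] f1]; split=> [|/=]; last by rewrite f1.
by split=> [a x y|x y|x] /=; rewrite ?lf ?mf ?sf ?lg ?mg ?sg.
Qed.

(* If [x^2 + y^2 = 1] with [x], [y] self-adjoint and commuting, then
   [f x + i f y] is unitary, and [f x] is its real part. *)
Lemma starhom_selfadj_le1 X Y (f : X -> Y) x : unital_starhom f ->
  star x = x -> `|x| <= 2^-1 -> `|f x| <= 1.
Proof.
move=> [[lf mf sf] f1] sx hx; have [y [sy cy xy]] := sqrt_exists sx hx.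
pose u := f x + 'i *: f y.
have su : star u = f x - 'i *: f y.
  by rewrite starD starZ -!sf sx sy conjCi scaleNr.
have nu : `|u| <= 1.
  suff: `|u| ^+ 2 <= 1 by rewrite expr_le1.
  rewrite -cstar_norm su (_ : _ * u = 1) ?norm1_le1//.
  rewrite /u mulrBl !mulrDr -!cstar_scaleAl -!cstar_scaleAr -!mf cy.
  rewrite scalerA -(expr2 'i) sqrCi scaleN1r opprD opprK addrA addrK.
  by rewrite -(linear_add lf) xy.
have -> : f x = 2^-1 *: (u + star u).
  by rewrite su /u addrACA subrr addr0 scalerDr -scalerDl half2 scale1r.
rewrite normrZ ger0_norm ?invr_ge0// ler_pdivrMl// mulr1.
by rewrite (le_trans (ler_normD _ _))// norm_star mulr2n lerD.
Qed.

Lemma starhom_bounded X Y (f : X -> Y) x : unital_starhom f ->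
  `|f x| ^+ 2 <= 2 * `|x| ^+ 2.
Proof.
move=> hf; have [[lf mf sf] _] := hf.
rewrite -!cstar_norm -sf -mf; set h := star x * x.
have sh : star h = h by rewrite starM starK.
have [->|h0] := eqVneq h 0; first by rewrite (linear0f lf) !normr0 mulr0.
have nh : 0 < `|h| by rewrite normr_gt0.
(* This scalar brings [h] to norm 1/2, the radius allowed by [starhom_selfadj_le1]. *)
pose c := (2 * `|h|)^-1; have c0 : 0 < c by rewrite invr_gt0 mulr_gt0.
have := @starhom_selfadj_le1 _ _ f (c *: h) hf.
rewrite starZ sh geC0_conj ?(ltW c0)// => /(_ erefl).
rewrite (linear_scale lf) !normrZ [`|c|]gtr0_norm// /c !ler_pdivrMl ?mulr_gt0// mulr1.
by apply; rewrite mulrAC divff ?mul1r// pnatr_eq0.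
Qed.

Lemma starhom_ker_closed_ideal X Y (f : X -> Y) : unital_starhom f ->
  closed_ideal [set x | f x = 0].
Proof.
move=> hf; have [[lf mf sf] _] := hf; split => /=.
(* A point [y] of the kernel within [e] of [x] gives [f x = f (x - y)], which the bound makes
   small. *)
- move=> x hx /=; apply: (@small_eq0 _ _ _ 2) => // e e0.
  have [y [/= fy]] := hx _ (nbhsx_ballx x e e0).
  rewrite -ball_normE /= => xy.
  have -> : f x = f (x - y) by rewrite (linear_sub lf) fy subr0.
  rewrite -(@ler_pXn2r _ 2) ?nnegrE ?mulr_ge0 ?(ltW e0)//.
  rewrite (le_trans (starhom_bounded _ hf))// exprMn ler_pM ?exprn_ge0//.
    by rewrite -natrX ler_nat.
  by rewrite lerXn2r ?nnegrE ?(ltW e0) ?(ltW xy).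
- exact: (linear0f lf).
- by move=> x y fx fy; rewrite (linear_add lf) fx fy addr0.
- by move=> a x fx; rewrite !mf fx mulr0 mul0r.
Qed.

End StarHom.

(** * Vanishing of self-adjoint corners *)

Section Corner.
Context {R : realType} {A : cstarType R}.
Implicit Types (p y : A) (a : R[i]).

Lemma norm_mean_sqr p y : `|p| <= 1 -> `|y| <= 1 -> `|2^-1 *: (p * p + y * y)| <= 1.
Proof.
move=> hp hy; rewrite normrZ ger0_norm ?invr_ge0// ler_pdivrMl// mulr1.
rewrite (le_trans (ler_normD _ _))// mulr2n lerD//.
  by rewrite (le_trans (cstar_normM _ _))// mulr_ile1.
by rewrite (le_trans (cstar_normM _ _))// mulr_ile1.
Qed.

Lemma mulDsqr p y a : p * p = p -> p * y = y -> y * p = y ->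
  (p + a *: y) * (p + a *: y) = p + (a + a) *: y + (a * a) *: (y * y).
Proof.
move=> pp py yp; rewrite mulrDl !mulrDr -!cstar_scaleAl -!cstar_scaleAr pp py yp.
by rewrite scalerA scalerDl !addrA.
Qed.

Let u : R[i] := 1 + 'i.
Let v : R[i] := 1 - 'i.

Lemma mul_ii : 'i * 'i = -1 :> R[i].
Proof. by rewrite -expr2 sqrCi. Qed.

Lemma sqr_1addi : u * u = 'i + 'i.
Proof. by rewrite /u; ring: mul_ii. Qed.

Lemma sqr_1subi : v * v = - ('i + 'i).
Proof. by rewrite /v; ring: mul_ii. Qed.

Lemma mul_1addi_1subi : u * v = 2.
Proof. by rewrite /u /v; ring: mul_ii. Qed.

(* Averaging the squares cancels the quadratic terms, because [(1 + i)^2] and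
   [(1 - i)^2] are opposite. *)
Lemma corner_mean p y a : p * p = p -> p * y = y -> y * p = y ->
  `|p + (a * u) *: y| <= 1 -> `|p + (a * v) *: y| <= 1 -> `|p + (2 * a) *: y| <= 1.
Proof.
move=> pp py yp hu hv; have := norm_mean_sqr hu hv.
rewrite !mulDsqr// ![a * _ * (a * _)]mulrACA sqr_1addi sqr_1subi mulrN scaleNr.
rewrite addrACA subrr addr0 addrACA -scalerDl -!mulrDr.
rewrite (_ : u + u + (v + v) = 2 * 2); last by rewrite /u /v; ring.
rewrite scalerDr scalerA [_ *: (p + p)]scalerDr -scalerDl half2 scale1r.
by rewrite (_ : 2^-1 * (a * (2 * 2)) = 2 * a)//; field.
Qed.

(** The scalars [a * u] are the four vertices [1 + i], [-1 + i], [-1 - i], [1 - i] of a square, here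
    scaled by [r]. *)
Let quarter p y (r : R[i]) := forall a, a \in [:: 1; 'i; -1; - 'i] ->
  `|p + (r * a * u) *: y| <= 1.

(** Each use of [corner_mean] rotates the square by an eighth of a turn and enlarges it by [sqrt 2].
    The first leads from the vertices to the axes ([h1]), the second back to vertices twice as
    far. *)
Lemma quarter_double p y r : p * p = p -> p * y = y -> y * p = y ->
  quarter p y r -> quarter p y (2 * r).
Proof.
move=> pp py yp h.
have roti a : a \in [:: 1; 'i; -1; - 'i] -> - 'i * a \in [:: 1; 'i; -1; - 'i].
  rewrite !inE => /or4P[] /eqP ->; rewrite ?mulr1 ?mulrN1 ?mulNr ?mulrN -?expr2
    ?sqrCi ?opprK eqxx ?orbT//.
have roti' a : a \in [:: 1; 'i; -1; - 'i] -> 'i * a \in [:: 1; 'i; -1; - 'i].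
  rewrite !inE => /or4P[] /eqP ->; rewrite ?mulr1 ?mulrN1 ?mulNr ?mulrN -?expr2
    ?sqrCi ?opprK eqxx ?orbT//.
have vE : v = - 'i * u by rewrite /u /v; ring: mul_ii.
have h1 a : a \in [:: 1; 'i; -1; - 'i] -> `|p + (2 * (r * a)) *: y| <= 1.
  move=> ha; apply: corner_mean => //; first exact: h.
  by rewrite vE mulrA -[_ * _ * - 'i]mulrA [a * _]mulrC; apply/h/roti.
move=> a ha; rewrite -!mulrA mulrA -[X in `|p + X *: y|]mulrA; apply: corner_mean => //.
  have -> : r * (a * u) * u = 2 * (r * ('i * a)).
    by rewrite /u; ring: mul_ii.
  exact/h1/roti'.
rewrite -!mulrA mul_1addi_1subi [a * 2]mulrC [r * _]mulrCA; exact: h1.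
Qed.

Lemma corner_eq0 p y : p * p = p -> p * y = y -> y * p = y ->
  star p = p -> star y = y -> `|p + y| <= 1 -> `|p - y| <= 1 -> y = 0.
Proof.
move=> pp py yp sp sy h1 h2.
(* For imaginary [a] the C*-identity turns the squared norm into that of [p + y^2], which is the
   mean of [(p + y)^2] and [(p - y)^2]. *)
have hi a : a \in [:: 'i; - 'i] -> `|p + a *: y| <= 1.
  move=> ha; suff: `|p + a *: y| ^+ 2 <= 1 by rewrite expr_le1.
  have [ca aa] : a^* = - a /\ a * a = -1.
    by move: ha; rewrite !inE => /orP[] /eqP ->; rewrite ?rmorphN /= conjCi ?mulrNN -?expr2 ?sqrCi.
  rewrite -cstar_norm starD starZ sp sy ca.
  rewrite (_ : _ * _ = 2^-1 *: ((p + y) * (p + y) + (p - y) * (p - y))) ?norm_mean_sqr//.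
  have hp := mulDsqr 1 pp py yp; have hm := mulDsqr (- 1) pp py yp.
  rewrite scale1r mulr1 scale1r in hp; rewrite scaleN1r mulrNN mulr1 scale1r in hm.
  rewrite hp hm addrACA (addrACA p) -scalerDl -opprD subrr scale0r addr0.
  rewrite mulrDl !mulrDr -!cstar_scaleAl -!cstar_scaleAr pp py yp scalerA mulNr aa opprK.
  rewrite scale1r scaleNr -[LHS]addrA addNKr (addrACA p).
  by rewrite scalerDr -scalerDl half2 scale1r.
(* The midpoints of one of [1], [-1] and one of ['i], [- 'i] are the vertices of the square with
   [r = 1/2]. *)
have quart0 : quarter p y 2^-1.
  have hr b : b \in [:: 1; -1] -> `|p + b *: y| <= 1.
    by rewrite !inE => /orP[] /eqP ->; rewrite ?scaleN1r ?scale1r.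
  have mean b c : b \in [:: 1; -1] -> c \in [:: 'i; - 'i] -> `|p + (2^-1 * (b + c)) *: y| <= 1.
    move=> /hr hb /hi hc.
    have -> : p + (2^-1 * (b + c)) *: y = 2^-1 *: (p + b *: y) + 2^-1 *: (p + c *: y).
      rewrite -scalerDr addrACA -scalerDl scalerDr scalerA; congr (_ + _).
      by rewrite scalerDr -scalerDl half2 scale1r.
    rewrite (le_trans (ler_normD _ _))// !normrZ ger0_norm ?invr_ge0// -mulrDr.
    by rewrite ler_pdivrMl// mulr1 mulr2n lerD.
  move=> a; rewrite !inE => /or4P[] /eqP ->; rewrite -mulrA /u.
  - by rewrite (_ : 1 * (1 + 'i) = 1 + 'i) ?mean ?inE ?eqxx ?orbT//; ring: mul_ii.
  - by rewrite (_ : 'i * (1 + 'i) = - 1 + 'i) ?mean ?inE ?eqxx ?orbT//; ring: mul_ii.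
  - by rewrite (_ : -1 * (1 + 'i) = - 1 + - 'i) ?mean ?inE ?eqxx ?orbT//; ring: mul_ii.
  - by rewrite (_ : - 'i * (1 + 'i) = 1 + - 'i) ?mean ?inE ?eqxx ?orbT//; ring: mul_ii.
have quartn n : quarter p y (2 ^+ n * 2^-1).
  elim: n => [|n IH]; first by rewrite mul1r.
  by rewrite exprS -mulrA; exact: quarter_double.
apply: (@small_eq0 _ _ _ 2) => // e /half_exp_lt[n hn].
have := quartn n 1; rewrite inE eqxx => /(_ isT) hp.
have := quartn n (-1); rewrite !inE eqxx !orbT => /(_ isT) hm.
have nu : 1 <= `|u|.
  have : 1 <= `|u| * `|v| by rewrite -normrM mul_1addi_1subi ger0_norm ?ler1n.
  have -> : `|v| = `|u|.
    by rewrite -norm_conjC rmorphB /= rmorph1 conjCi opprK.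
  by rewrite -expr2 expr_ge1.
(* Both [p + w] and [p - w] have norm at most 1, hence [|2 w| <= 2] for every [n], while [w] grows
   like [2^n y]. *)
pose w := (2 ^+ n * 2^-1 * u) *: y.
have nw : `|2 *: w| <= 2.
  rewrite (_ : 2 *: w = w + w) ?scaler_nat ?mulr2n// (_ : w + w = (p + w) - (p - w)); last first.
    by rewrite opprB [RHS]addrC addrA addrNK.
  rewrite (le_trans (ler_normB _ _))// lerD// /w.
    by move: hp; rewrite mulr1.
  by move: hm; rewrite mulrN1 mulNr scaleNr.
have nw2 : 2 ^+ n * (`|u| * `|y|) <= 2.
  move: nw; rewrite /w scalerA !normrZ.
  rewrite (_ : 2 * (2 ^+ n / 2 * u) = 2 ^+ n * u); last by field.
  by rewrite normrM mulrA [`|2 ^+ n|]ger0_norm ?exprn_ge0.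
have yu : `|y| <= `|u| * `|y| by rewrite ler_peMl.
have := le_trans (ler_wpM2l (exprn_ge0 n (ler0n _ 2)) yu) nw2.
rewrite -ler_pdivlMl ?exprn_gt0// => /le_trans; apply.
by rewrite -exprVn mulrC ler_wpM2l// ltW.
Qed.

End Corner.

(** * Orthogonality of the ranges of Cuntz isometries *)

Section CuntzOrthogonal.
Context {R : realType} {A : cstarType R} {n : nat} {s : 'I_n -> A}.
Hypothesis hs : cuntz_relations s.

Let P k := s k * star (s k).

Lemma star_range k : star (P k) = P k.
Proof. by rewrite starM starK. Qed.

Lemma range_idem k : P k * P k = P k.
Proof. by case: hs => h _; rewrite /P mulrA -(mulrA (s k)) h mulr1. Qed.

Lemma norm_corner_le1 j k : `|P j - P j * P k * P j| <= 1.
Proof.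
have -> : P j - P j * P k * P j = P j * (1 - P k) * P j.
  by rewrite mulrBr mulr1 mulrBl range_idem.
have hk : `|1 - P k| <= 1.
  apply: norm_proj_le1; first by rewrite starB star1 star_range.
  by rewrite mulrBr mulr1 mulrBl mul1r range_idem subrr subr0.
have hj : `|P j| <= 1 := norm_proj_le1 (star_range j) (range_idem j).
rewrite (le_trans (cstar_normM _ _))// mulr_ile1//.
by rewrite (le_trans (cstar_normM _ _))// mulr_ile1.
Qed.

(** The element is the mean of [n] contractions: [P j - P j * P k * P j] when [Q k] holds, and [P j]
    otherwise. *)
Lemma norm_corner_sum j (Q : pred 'I_n) :
  `|P j - n%:R^-1 *: \sum_(k | Q k) P j * P k * P j| <= 1.
Proof.
have n0 : (0 < n)%N by case: (n) j => // -[].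
have nR : n%:R != 0 :> R[i] by rewrite pnatr_eq0 -lt0n.
have -> : P j - n%:R^-1 *: \sum_(k | Q k) P j * P k * P j =
    n%:R^-1 *: \sum_k (P j - if Q k then P j * P k * P j else 0).
  rewrite sumrB sumr_const card_ord scalerBr -big_mkcond; congr (_ - _).
  by rewrite -(scaler_nat n (P j)) scalerA mulVf// scale1r.
rewrite normrZ ger0_norm ?invr_ge0// ler_pdivrMl ?ltr0n// mulr1.
rewrite (le_trans (ler_norm_sum _ _ _))//.
have -> : n%:R = \sum_(k < n) 1 :> R[i] by rewrite sumr_const card_ord.
apply: ler_sum => k _; case: ifP => _; first exact: norm_corner_le1.
by rewrite subr0 (norm_proj_le1 (star_range j) (range_idem j)).
Qed.

Lemma cuntz_orthogonal i j : i != j -> star (s i) * s j = 0.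
Proof.
move=> ij; have [h1 h2] := hs.
have n0 : n%:R != 0 :> R[i] by case: (n) i {ij} => [[]//|m _]; rewrite pnatr_eq0.
set x := P j * P i * P j.
(* Compressing [\sum_k P k = 1] by [P j] leaves corners with sum 0 over [k != j]. Thus both signs of
   [x / n] are reached by [norm_corner_sum], with the complementary predicates used below. *)
have sumx : \sum_(k | (k != j) && (k != i)) P j * P k * P j = - x.
  have : \sum_k P j * P k * P j = P j by rewrite -mulr_suml -mulr_sumr h2 mulr1 range_idem.
  rewrite (bigD1 j)//= (bigD1 i)//= -/x !range_idem -[RHS]addr0 => /addrI xS.
  by apply: (@addrI _ x); rewrite subrr.
have y0 : n%:R^-1 *: x = 0.
  apply: (@corner_eq0 _ _ (P j)); first exact: range_idem.
  - by rewrite -cstar_scaleAr /x (mulrA _ (P j * P i)) (mulrA _ (P j) (P i)) range_idem.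
  - by rewrite -cstar_scaleAl /x -(mulrA (P j * P i)) range_idem.
  - exact: star_range.
  - rewrite starZ geC0_conj ?invr_ge0// /x starM star_range starM !star_range.
    by rewrite mulrA.
  - by have := norm_corner_sum j (fun k => (k != j) && (k != i)); rewrite sumx scalerN opprK.
  - by have := norm_corner_sum j (pred1 i); rewrite big_pred1_eq.
have x0 : x = 0 by rewrite -[x]scale1r -(mulfV n0) -scalerA y0 scaler0.
(* [x] is the adjoint of [P i * P j] times [P i * P j]. *)
have : `|P i * P j| ^+ 2 = 0.
  by rewrite -cstar_norm starM !star_range mulrA -(mulrA (P j)) range_idem -/x x0 normr0.
move/eqP; rewrite expf_eq0 normr_eq0 /= => /eqP pp.
have := congr1 (fun z => star (s i) * z * s j) pp.
by rewrite /= mulr0 mul0r /P !mulrA h1 mul1r -!mulrA h1 mulr1.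
Qed.

End CuntzOrthogonal.

(** * States and creation operators on [L^2(B, psi)] *)

Lemma polarization {C : numClosedFieldType} (p q r : C) : 0 <= r ->
  (forall a, 0 <= 1 + a * p + (a^* * q + a^* * (a * r))) -> q = p^*.
Proof.
move=> r0 h.
(* A nonnegative scalar is its own conjugate; the cases [a = 1] and [a = 'i] then determine [q] from
   [p]. *)
have real a : a^* * p^* + a * q^* = a * p + a^* * q.
  have := geC0_conj (h a); rewrite !rmorphD !rmorphM /= rmorph1 conjCK (geC0_conj r0) => ha.
  apply: (@addrI _ (1 + a^* * (a * r))).
  have -> : 1 + a^* * (a * r) + (a * p + a^* * q) = 1 + a * p + (a^* * q + a^* * (a * r)) by ring.
  by rewrite -ha; ring.
have := real 1; have := real 'i; rewrite rmorph1 conjCi !mul1r.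
move: (p^*) (q^*) => p' q' h1 h2.
have i2 : 'i * 'i = -1 :> C by rewrite -expr2 sqrCi.
have : 2 * q = 2 * p'.
  have -> : 2 * q = (p + q) + 'i * ('i * p + - 'i * q) by ring: i2.
  by rewrite -h1 -h2; ring: i2.
by move/(mulfI _); apply; rewrite pnatr_eq0.
Qed.

Section Representations.
Context {R : realType} {B : cstarType R} {psi : {scalar B}} {n : nat}
  {e : 'I_n -> B}.

Definition orthonormal_basis :=
  (forall i j, psi (star (e i) * e j) = (i == j)%:R) /\
  (forall b, b = \sum_i psi (star (e i) * b) *: e i).

(* [V x] is the creation operator of the vector [x] of [L^2(B, psi)]. *)
Definition cuntz_representation (D : cstarType R) (V : B -> D) :=
  [/\ linear V, forall x y, star (V x) * V y = psi (star x * y) *: (1 : D)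
    & \sum_j V (e j) * star (V (e j)) = 1].

Lemma state_star : faithful_state psi -> forall x, psi (star x) = (psi x)^*.
Proof.
case=> psi_ge0 psi1 _ x; apply: (polarization (psi_ge0 x)) => a.
have := psi_ge0 (1 + a *: x).
rewrite starD star1 starZ mulrDl !mulrDr !mul1r mulr1.
by rewrite -!cstar_scaleAl -!cstar_scaleAr !linearD !linearZ /= psi1.
Qed.

Context {D : cstarType R} {V : B -> D}.
Hypotheses (psi_state : faithful_state psi) (he : orthonormal_basis)
  (hV : cuntz_representation V).

Definition left_rep b := \sum_j V (b * e j) * star (V (e j)).
Definition canonical_shift y := \sum_j V (e j) * y * star (V (e j)).

Lemma rep_expand (f : B -> B) x : linear f ->
  \sum_j psi (star (e j) * x) *: V (f (e j)) = V (f x).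
Proof.
case: hV => lV _ _ lf; case: he => _ hx; rewrite {2}[x]hx.
rewrite (linear_bigsum lf) (linear_bigsum lV); apply: eq_bigr => j _.
by rewrite (linear_scale lf) (linear_scale lV).
Qed.

Lemma left_repV b x : left_rep b * V x = V (b * x).
Proof.
case: hV => lV VV _; rewrite mulr_suml -(@rep_expand ( *%R b)); last first.
  by move=> a y z; rewrite mulrDr cstar_scaleAr.
by apply: eq_bigr => j _; rewrite -mulrA VV -cstar_scaleAr mulr1.
Qed.

Lemma shiftV y x : canonical_shift y * V x = V x * y.
Proof.
case: hV => lV VV _; rewrite mulr_suml -{2}(@rep_expand id) // mulr_suml.
by apply: eq_bigr => j _; rewrite -mulrA VV -cstar_scaleAr mulr1 -cstar_scaleAl.
Qed.

(** The ranges of the [V (e j)] fill the whole space: multiply by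
    [\sum_j V (e j) * star (V (e j)) = 1] on the right. *)
Lemma rep_ext y z : (forall x, y * V x = z * V x) -> y = z.
Proof.
move=> h; case: hV => _ _ V1; rewrite -[y]mulr1 -[z]mulr1 -V1 !mulr_sumr.
by apply: eq_bigr => j _; rewrite !mulrA h.
Qed.

Lemma rep_ext2 y z :
  (forall x x', star (V x) * y * V x' = star (V x) * z * V x') -> y = z.
Proof.
move=> h; apply: rep_ext => x'; rewrite -[LHS]starK -[RHS]starK; congr star.
apply: rep_ext => x; rewrite -[LHS]starK -[RHS]starK; congr star.
by rewrite [LHS]starM [RHS]starM !starK !mulrA.
Qed.

Lemma left_rep_starhom : unital_starhom left_rep.
Proof.
have [lV VV V1] := hV; split.
  split.
  - move=> a x y; rewrite scaler_sumr -big_split; apply: eq_bigr => j _ /=.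
    by rewrite mulrDl -cstar_scaleAl lV mulrDl cstar_scaleAl.
  - by move=> x y; apply: rep_ext => z; rewrite -mulrA !left_repV mulrA.
  (* Between [V y] and [V z] both sides have the matrix coefficient [psi (y^* x^* z)]. *)
  - move=> x; apply: rep_ext2 => y z; rewrite -mulrA left_repV VV.
    rewrite -[star (V y) * _]starK starM !starK left_repV -[V z]starK -starM VV.
    by rewrite starZ star1 -(state_star psi_state) !starM !starK mulrA.
by rewrite -[RHS]V1; apply: eq_bigr => j _; rewrite mul1r.
Qed.

Lemma shift_starhom : unital_starhom canonical_shift.
Proof.
have [lV VV V1] := hV; split.
  split.
  - move=> a x y; rewrite scaler_sumr -big_split; apply: eq_bigr => j _ /=.
    by rewrite mulrDr mulrDl -cstar_scaleAr -cstar_scaleAl.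
  - by move=> x y; apply: rep_ext => z; rewrite -mulrA !shiftV mulrA -shiftV mulrA.
  - move=> x; rewrite star_sum; apply: eq_bigr => j _.
    by rewrite !starM starK mulrA.
by rewrite -[RHS]V1; apply: eq_bigr => j _; rewrite mulr1.
Qed.

Lemma left_rep_shift b y : left_rep b * canonical_shift y = canonical_shift y * left_rep b.
Proof.
by apply: rep_ext => x; rewrite -!mulrA shiftV !left_repV shiftV mulrA left_repV.
Qed.

End Representations.

Arguments orthonormal_basis {R B} psi {n} e.
Arguments cuntz_representation {R B} psi {n} e {D} V.
Arguments left_rep {R B n} e {D} V b.
Arguments canonical_shift {R B n} e {D} V y.

(** * Linear maps and *-homomorphisms on tensor products *)

Section TensorProducts.
Context {R : realType} {X Y Z : cstarType R} {t : X -> Y -> Z}.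
Hypothesis ht : tensor_product t.

(** This is the uniqueness half of the universal property, for the bilinear map [f (t x y)]. *)
Lemma tensor_linear_ext (V : lmodType R[i]) (f g : Z -> V) : linear f -> linear g ->
  (forall x y, f (t x y) = g (t x y)) -> forall z, f z = g z.
Proof.
have [[tl tr] _ _ univ] := ht => lf lg fg z.
have [|y a x x'|h [_ uh]] := univ V (fun x y => f (t x y)).
- by move=> y a x x'; rewrite tl lf.
- by rewrite tr lf.
- by rewrite -(uh f (conj lf _))// (uh g (conj lg _)).
Qed.

Lemma tensor_unit : t 1 1 = 1.
Proof.
have [[tl tr] tM tS _] := ht.
rewrite -[LHS]mulr1; apply: (@tensor_linear_ext _ ( *%R (t 1 1)) id) => //.
  by move=> a x y; rewrite mulrDr cstar_scaleAr.
by move=> x y; rewrite tM !mul1r.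
Qed.

Lemma tensor_starhom_extend (D : cstarType R) (f : X -> D) (g : Y -> D) :
  unital_starhom f -> unital_starhom g -> (forall x y, f x * g y = g y * f x) ->
  exists h : Z -> D, unital_starhom h /\ forall x y, h (t x y) = f x * g y.
Proof.
have [[tl tr] tM tS univ] := ht => -[[lf fM fS] f1] [[lg gM gS] g1] fg.
have [|x a y y'|h [[lh hE] _]] := univ D (fun x y => f x * g y).
- by move=> y a x x'; rewrite lf mulrDl cstar_scaleAl.
- by rewrite lg mulrDr cstar_scaleAr.
exists h; split=> //; split; last by rewrite -tensor_unit hE f1 g1 mulr1.
split=> //.
- move=> z w; apply: (@tensor_linear_ext _ (fun z => h (z * w)) (fun z => h z * h w))
    => [a p q|a p q|x y].
  + by rewrite mulrDl -cstar_scaleAl lh.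
  + by rewrite lh mulrDl -cstar_scaleAl.
  apply: (@tensor_linear_ext _ (fun w => h (t x y * w)) (fun w => h (t x y) * h w))
    => [a p q|a p q|x' y'].
  + by rewrite mulrDr -cstar_scaleAr lh.
  + by rewrite lh mulrDr -cstar_scaleAr.
  by rewrite tM !hE fM gM !mulrA -(mulrA (f x)) fg !mulrA.
- move=> z; rewrite -[LHS]starK; congr star.
  (* Taking adjoints before and after [h] restores linearity, so that elementary tensors suffice. *)
  apply: (@tensor_linear_ext _ (fun z => star (h (star z))) h) => // [a p q|x y].
    by rewrite starD starZ lh starD starZ conjCK.
  by rewrite tS !hE fS gS starM !starK -fg.
Qed.

End TensorProducts.

(** Each representation of a tensor power is only known to exist, given the previous one; the
    invariant [Q] is carried along the choices. *)
Lemma dependent_choice (T : nat -> Type) (Q : forall k, T k -> Prop)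
    (S : forall k, T k -> T k.+1 -> Prop) (x0 : T 0%N) :
  Q 0%N x0 -> (forall k x, Q k x -> exists y, Q k.+1 y /\ S k x y) ->
  exists F : forall k, T k,
    [/\ F 0%N = x0, forall k, Q k (F k) & forall k, S k (F k) (F k.+1)].
Proof.
move=> q0 step.
have stepT k (x : {x | Q k x}) : {y : {y | Q k.+1 y} | S k (sval x) (sval y)}.
  by have /cid[y [qy sy]] := step k _ (svalP x); exists (exist _ y qy).
pose F := nat_rect (fun k => {x | Q k x}) (exist _ x0 q0) (fun k x => sval (stepT k x)).
exists (fun k => sval (F k)); split=> // k; first exact: (svalP (F k)).
exact: (svalP (stepT k (F k))).
Qed.

(** * Elementary tensors determine maps on the infinite tensor power *)

Section InfiniteTensorPower.
Context {R : realType} {B : cstarType R} {BN : infinite_tensor_power B}.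

Let u := itp_pow0 BN.
Let t := @itp_tensor R B BN.
Let j := @itp_inj R B BN.

Lemma elementary_eq x y k : (forall m, (m <= k)%N -> x m = y m) ->
  elementary u t x k = elementary u t y k.
Proof.
elim: k => [|k IH] h /=; first by rewrite h.
by rewrite IH ?h// => m mk; rewrite h// leqW.
Qed.

Lemma elementary_linear_ext k (V : lmodType R[i]) (f g : itp_pow BN k -> V) :
  linear f -> linear g ->
  (forall x, f (elementary u t x k) = g (elementary u t x k)) -> f =1 g.
Proof.
elim: k f g => [|k IH] f g lf lg h.
  have [_ [u' _ uK]] := itp_pow0P BN.
  by move=> z; rewrite -[z]uK; exact: (h (fun=> u' z)).
apply: (tensor_linear_ext (@itp_tensorP R B BN k)) => // p b; move: p.
have [[tl _] _ _ _] := @itp_tensorP R B BN k.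
apply: IH => [a p q|a p q|x]; rewrite ?tl ?lf ?lg//.
(* Replacing the entries of [x] after index [k] by [b] makes the elementary tensor of level [k + 1]
   equal to that of [x] at level [k], tensored with [b]. *)
have := h (fun m => if (m <= k)%N then x m else b); rewrite /= ltnn.
by rewrite (@elementary_eq _ x k)// => m ->.
Qed.

Lemma itp_starhom_ext (D : cstarType R) (f g : BN -> D) :
  unital_starhom f -> unital_starhom g ->
  (forall k x, f (j (elementary u t x k)) = g (j (elementary u t x k))) -> f = g.
Proof.
move=> hf hg h; have [jh jc univ] := itp_limitP BN.
have [|k x|th [_ uth]] := univ D (fun k x => f (j x)).
- by move=> k; exact: (unital_starhom_comp hf (jh k)).
- by rewrite /j jc.
rewrite -(uth f)//; apply: uth; split=> // k x; move: x.
have [[lf _ _] _] := hf; have [[lg _ _] _] := hg; have [[lj _ _] _] := jh k.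
apply: elementary_linear_ext => [a p q|a p q|x]; first by rewrite lj lg.
  by rewrite /j lj lf.
by rewrite -h.
Qed.

Lemma itp_one : (1 : BN) = j (u 1).
Proof.
have [jh _ _] := itp_limitP BN; have [[_ u1] _] := itp_pow0P BN.
by rewrite /u /j u1; case: (jh 0%N) => _ ->.
Qed.

Lemma itp_first1 b : itp_first b 1 = j (u b) :> BN.
Proof.
have [_ jc _] := itp_limitP BN.
rewrite itp_one (@itp_first_elementary _ _ BN b (fun=> 1) 0%N) /=.
exact: jc.
Qed.

Lemma itp_first_starhom1 : unital_starhom (itp_first (i := BN) 1).
Proof.
have [[_ tr] tM tS _] := itp_firstP BN; split; last exact: (tensor_unit (itp_firstP BN)).
split=> [|x y|x]; first exact: tr.
  by rewrite tM mulr1.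
by rewrite tS star1.
Qed.

Lemma itp_firstE b f : itp_first b f = itp_first b 1 * itp_first 1 f :> BN.
Proof. by have [_ tM _ _] := itp_firstP BN; rewrite tM mulr1 mul1r. Qed.

(** The recursion removes the first tensor factor, so induction on the length fixes the values on
    elementary tensors. *)
Lemma itp_recursive_ext (D : cstarType R) (p : B -> D) (r : D -> D) (f g : BN -> D) :
  unital_starhom f -> unital_starhom g ->
  (forall b h, f (itp_first b h) = p b * r (f h)) ->
  (forall b h, g (itp_first b h) = p b * r (g h)) -> f = g.
Proof.
move=> hf hg fE gE; apply: itp_starhom_ext => // k.
elim: k => [|k IH] x.
  by rewrite /= -itp_first1 fE gE; case: hf hg => _ -> [_ ->].
have xE : prepend (x 0%N) (fun m => x m.+1) = x by apply: funext => -[].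
have := @itp_first_elementary _ _ BN (x 0%N) (fun m => x m.+1) k.
by rewrite xE -/u -/t -/j => <-; rewrite fE gE IH.
Qed.

End InfiniteTensorPower.

Lemma unital_starhom_inverse {R : realType} (X Y : cstarType R) (f : X -> Y) (g : Y -> X) :
  unital_starhom f -> cancel f g -> cancel g f -> unital_starhom g.
Proof.
move=> [[lf fM fS] f1] fK gK; split; last by rewrite -f1 fK.
split=> [a x y|x y|x]; apply: (can_inj fK).
- by rewrite lf !gK.
- by rewrite fM !gK.
- by rewrite fS !gK.
Qed.

Lemma unital_starhom_iter {R : realType} (X : cstarType R) (f : X -> X) k :
  unital_starhom f -> unital_starhom (iter k f).
Proof.
by move=> hf; elim: k => [|k IH]; [|exact: (unital_starhom_comp hf IH)].
Qed.

(** * The representation of [B^{\otimes N}] built from creation operators *)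

Section TensorPowerRepresentation.
Context {R : realType} {B : cstarType R} {psi : {scalar B}} {n : nat}
  {e : 'I_n -> B} {D : cstarType R} {V : B -> D} {BN : infinite_tensor_power B}.
Hypotheses (psi_state : faithful_state psi) (he : orthonormal_basis psi e)
  (hV : cuntz_representation psi e V).

Let pi := left_rep e V.
Let rho := canonical_shift e V.
Let u := itp_pow0 BN.
Let t := @itp_tensor R B BN.

(* On [B^{\otimes (k+1)}] the representation is
   [b_0 \otimes ... \otimes b_k |-> pi b_0 * rho (pi b_1) * ... * rho^k (pi b_k)]. *)
Lemma finite_tensor_representation : exists phi : forall k, itp_pow BN k -> D,
  [/\ forall k, unital_starhom (phi k), forall b, phi 0%N (u b) = pi b
    & forall k p b, phi k.+1 (t p b) = phi k p * iter k.+1 rho (pi b)].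
Proof.
have [uh [u' uK u'K]] := itp_pow0P BN.
have pih : unital_starhom pi := left_rep_starhom psi_state he hV.
have rhoh : unital_starhom rho := shift_starhom he hV.
have pi_rho b y : pi b * rho y = rho y * pi b := left_rep_shift he hV b y.
(* Commutation with the range of [rho^(k+1)] is exactly what allows the next tensor factor to be
   added. *)
pose good k (f : itp_pow BN k -> D) := unital_starhom f /\
  forall x y, f x * iter k.+1 rho y = iter k.+1 rho y * f x.
have good0 : good 0%N (pi \o u').
  split; first exact: (unital_starhom_comp pih (unital_starhom_inverse uh uK u'K)).
  by move=> x y; exact: pi_rho.
have step k f : good k f -> exists g, good k.+1 g /\
    forall p b, g (t p b) = f p * iter k.+1 rho (pi b).
  move=> [fh fc].
  have gh := unital_starhom_comp (unital_starhom_iter k.+1 rhoh) pih.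
  have [|g [hg gE]] := tensor_starhom_extend (@itp_tensorP R B BN k) fh gh.
    by move=> x y; exact: fc.
  exists g; split=> //; split=> // x y.
  have [[lg _ _] _] := hg.
  apply: (tensor_linear_ext (@itp_tensorP R B BN k) (f := fun x => g x * _)
    (g := fun x => _ * g x)) => [a p q|a p q|p b].
  - by rewrite lg mulrDl cstar_scaleAl.
  - by rewrite lg mulrDr cstar_scaleAr.
  have [[_ IM _] _] := unital_starhom_iter k.+1 rhoh.
  rewrite gE (iterSr k.+1 rho y) -mulrA -IM pi_rho IM.
  by rewrite mulrA fc -mulrA.
have [phi [phi0 phi_good phiS]] := dependent_choice good0 step.
exists phi; split=> [k|b|//]; first by case: (phi_good k).
by rewrite phi0 /= uK.
Qed.

Lemma tensor_power_representation : exists phi : BN -> D, unital_starhom phi /\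
  forall b f, phi (itp_first b f) = pi b * rho (phi f).
Proof.
have [pi1h pi1] := left_rep_starhom psi_state he hV.
have rhoh : unital_starhom rho := shift_starhom he hV.
have [rhoh' rho1] := rhoh; have [lrho rhoM _] := rhoh'.
have [phi_ [phih phi0 phiS]] := finite_tensor_representation.
have phi_prepend b x k : phi_ k.+1 (elementary u t (prepend b x) k.+1) =
    pi b * rho (phi_ k (elementary u t x k)).
  elim: k => [|k IH]; first by rewrite phiS !phi0.
  by rewrite [elementary _ _ _ k.+2]/= phiS IH [elementary _ _ x k.+1]/= phiS rhoM mulrA.
have [_ jc /(_ D phi_ phih)] := itp_limitP BN; case=> [k x|phi [[phiH phiE] _]].
  rewrite phiS (_ : pi 1 = 1)//.
  by case: (unital_starhom_iter k.+1 rhoh) => _ ->; rewrite mulr1.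
have phi_elem b x k : phi (itp_first b (itp_inj (elementary u t x k))) =
    pi b * rho (phi (itp_inj (elementary u t x k))).
  by rewrite itp_first_elementary !phiE phi_prepend.
(* With [b \otimes f = (b \otimes 1)(1 \otimes f)], the recursion splits into this intertwining
   relation and [phi_one]. *)
have phi_shift : phi \o itp_first 1 = rho \o phi.
  apply: itp_starhom_ext => [||k x].
  - exact: (unital_starhom_comp phiH itp_first_starhom1).
  - exact: (unital_starhom_comp rhoh phiH).
  by rewrite /= phi_elem [pi 1]pi1 mul1r.
have phi_one b : phi (itp_first b 1) = pi b.
  by rewrite itp_first1 phiE phi0.
exists phi; split=> // b f; have [[_ phiM _] _] := phiH.
by rewrite itp_firstE phiM phi_one; congr (_ * _); exact: (congr1 (fun g => g f) phi_shift).
Qed.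

End TensorPowerRepresentation.

(** * Gram-Schmidt for the inner product of [psi] *)

Section OrthonormalFamilies.
Context {R : realType} {B : cstarType R} {psi : {scalar B}}.
Hypothesis psi_state : faithful_state psi.

Definition orthonormal_seq (s : seq B) := forall i j, (i < size s)%N ->
  (j < size s)%N -> psi (star s`_i * s`_j) = (i == j)%:R.

Definition seq_residue (s : seq B) b :=
  b - \sum_(i < size s) psi (star s`_i * b) *: s`_i.

Lemma residue_orthogonal s b i : orthonormal_seq s -> (i < size s)%N ->
  psi (star s`_i * seq_residue s b) = 0.
Proof.
move=> hs hi; rewrite mulrBr linearB /= mulr_sumr linear_sum /=.
rewrite (bigD1 (Ordinal hi))//= big1 ?addr0 => [|j ij]; last first.
  rewrite -cstar_scaleAr linearZ /= hs// eq_sym.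
  by move: ij; rewrite -val_eqE /= => /negPf ->; rewrite mulr0.
by rewrite -cstar_scaleAr linearZ /= hs// eqxx mulr1 subrr.
Qed.

Lemma orthonormal_extend s b : orthonormal_seq s -> seq_residue s b != 0 ->
  exists w, orthonormal_seq (rcons s w).
Proof.
have [psi_ge0 _ psi_faithful] := psi_state.
move=> hs; set v := seq_residue s b => v0.
have vv : 0 < psi (star v * v).
  rewrite lt_def psi_ge0 andbT; apply: contra_neq v0; exact: psi_faithful.
pose c := (sqrtC (psi (star v * v)))^-1.
have c0 : 0 < c by rewrite invr_gt0 sqrtC_gt0.
have orth i : (i < size s)%N -> psi (star s`_i * (c *: v)) = 0.
  by move=> hi; rewrite -cstar_scaleAr linearZ /= residue_orthogonal// mulr0.
exists (c *: v) => i j; rewrite size_rcons !ltnS !nth_rcons.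
case: (ltngtP i (size s)) => // hi _; case: (ltngtP j (size s)) => // hj _.
- exact: hs.
- by rewrite orth// hj ltn_eqF.
- rewrite -[_ * _]starK state_star// starM starK orth// conjC0.
  by rewrite hi eq_sym ltn_eqF.
rewrite hi hj eqxx starZ geC0_conj ?(ltW c0)// -cstar_scaleAl -cstar_scaleAr.
rewrite !linearZ /= mulrA -expr2 /c exprVn sqrtCK mulVf// gt_eqF//.
Qed.

Lemma orthonormal_independent s (k : 'I_(size s) -> R[i]) : orthonormal_seq s ->
  \sum_i k i *: s`_i = 0 -> forall i, k i = 0.
Proof.
move=> hs k0 i; have := congr1 (fun x => psi (star s`_i * x)) k0.
rewrite /= mulr0 linear0 mulr_sumr linear_sum /= (bigD1 i)//= big1 ?addr0 => [|j ij].
  by rewrite -cstar_scaleAr linearZ /= hs// eqxx mulr1.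
rewrite -cstar_scaleAr linearZ /= hs// eq_sym.
by move: ij; rewrite -val_eqE /= => /negPf ->; rewrite mulr0.
Qed.

End OrthonormalFamilies.

Lemma orthonormal_basis_exists {R : realType} (B : fdCstarType R) (psi : {scalar B}) :
  faithful_state psi -> exists n (e : 'I_n -> B), n = \dim {:B} /\ orthonormal_basis psi e.
Proof.
move=> psi_state.
have free_orth (s : seq B) : @orthonormal_seq R B psi s -> free (in_tuple s).
  move=> hs; apply/freeP => k k0 i.
  exact: (@orthonormal_independent R B psi s k hs k0).
have size_orth (s : seq B) : @orthonormal_seq R B psi s -> (size s <= \dim {:B})%N.
  move=> /free_orth; rewrite /free /= => /eqP <-; exact: dimvS (subvf _).
(* Orthonormal lists are free, hence of bounded length. In a longest one every residue vanishes,
   since a nonzero one could be normalised and appended. *)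
pose Q k := `[< exists2 s : seq B, size s = k & @orthonormal_seq R B psi s >].
have exQ : exists k, Q k by exists 0%N; apply/asboolP; exists [::].
have boundQ k : Q k -> (k <= \dim {:B})%N by move=> /asboolP[s <-]; exact: size_orth.
case: (ex_maxnP exQ boundQ) => n /asboolP[s sn hs] maxn.
have complete b : @seq_residue R B psi s b = 0.
  apply: contrapT => /eqP r0; have [w hw] := @orthonormal_extend R B psi psi_state s b hs r0.
  have : Q n.+1 by apply/asboolP; exists (rcons s w); rewrite ?size_rcons ?sn.
  by move=> /maxn; rewrite ltnn.
exists (size s), (fun i => s`_i); split; last first.
  split=> [i j|b]; first by rewrite hs.
  by apply/eqP; rewrite -subr_eq0; apply/eqP; exact: complete.
have := free_orth s hs; rewrite /free /= => /eqP <-.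
suff -> : <<s>>%VS = fullv by [].
apply/eqP; rewrite eqEsubv subvf; apply/subvP => b _ /=.
have := complete b; rewrite /seq_residue => /eqP; rewrite subr_eq0 => /eqP ->.
apply: memv_suml => i _; apply: memvZ; apply: memv_span; exact: mem_nth.
Qed.

(** * From Cuntz generators to creation operators *)

Section CuntzRepresentation.
Context {R : realType} {B : cstarType R} {psi : {scalar B}} {n : nat}
  {e : 'I_n -> B} {D : cstarType R}.
Hypotheses (psi_state : faithful_state psi) (he : orthonormal_basis psi e).

Definition creation (s : 'I_n -> D) x := \sum_i psi (star (e i) * x) *: s i.

Lemma creation_basis s i : creation s (e i) = s i.
Proof.
case: he => h _; rewrite /creation (bigD1 i)//= big1 ?addr0 => [|j ji].
  by rewrite h eqxx scale1r.
by rewrite h (negPf ji) scale0r.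
Qed.

Lemma creation_linear s : linear (creation s).
Proof.
move=> a x y; rewrite scaler_sumr -big_split; apply: eq_bigr => i _ /=.
by rewrite mulrDr -cstar_scaleAr linearD linearZ /= scalerDl scalerA.
Qed.

(** Orthogonality of the ranges kills the cross terms, and Parseval's identity for [e] gives the
    inner product. *)
Lemma creation_representation s : cuntz_relations s ->
  cuntz_representation psi e (creation s).
Proof.
move=> hs; have [h1 h2] := hs; split; first exact: creation_linear.
  move=> x y; rewrite {2}[y](he.2) star_sum mulr_suml mulr_sumr linear_sum scaler_suml.
  apply: eq_bigr => i _ /=; rewrite mulr_sumr (bigD1 i)//= big1 ?addr0 => [|j ji].
    rewrite starZ -!cstar_scaleAl -!cstar_scaleAr h1 scalerA linearZ /= mulrC.
    by rewrite -state_star// starM starK.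
  rewrite -cstar_scaleAr starZ -cstar_scaleAl (cuntz_orthogonal hs) ?scaler0//.
  by rewrite eq_sym.
by rewrite -[RHS]h2; apply: eq_bigr => i _; rewrite creation_basis.
Qed.

End CuntzRepresentation.

Arguments creation {R B} psi {n} e {D} s x.

Lemma starhom_factor {R : realType} (X Y Z : cstarType R) (q : X -> Y) (f : X -> Z) :
  unital_starhom q -> (forall y, exists x, q x = y) -> unital_starhom f ->
  (forall x, q x = 0 -> f x = 0) ->
  exists g : Y -> Z, unital_starhom g /\ forall x, g (q x) = f x.
Proof.
move=> [[lq qM qS] q1] q_surj [[lf fM fS] f1] ker.
have fq x y : q x = q y -> f x = f y.
  move=> xy; apply/eqP; rewrite -subr_eq0 -(linear_sub lf); apply/eqP/ker.
  by rewrite (linear_sub lq) xy subrr.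
have [r rK] := choice q_surj.
have gq x : f (r (q x)) = f x by apply: fq; rewrite rK.
exists (f \o r); split=> //; split; last by rewrite /= -q1 gq.
split=> [a x y|x y|x] /=.
- by rewrite -lf; apply: fq; rewrite lq !rK.
- by rewrite -fM; apply: fq; rewrite qM !rK.
- by rewrite -fS; apply: fq; rewrite qS !rK.
Qed.

(** * The Toeplitz relations and the isomorphism *)

Section ExelSystem.
Context {R : realType} {B : cstarType R} {psi : {scalar B}} {n : nat}
  {e : 'I_n -> B} {BN : infinite_tensor_power B} {alpha L : BN -> BN}.
Hypotheses (psi_state : faithful_state psi) (he : orthonormal_basis psi e)
  (alphaE : forall f, alpha f = itp_first 1 f)
  (LE : forall b f, L (itp_first b f) = psi b *: f)
  (linL : linear L).

Section Toeplitz.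
Context {D : cstarType R} {g : BN -> D} {S : D}.
Hypothesis rel : toeplitz_relations alpha L g S.

Definition toeplitz_creation x := g (itp_first x 1) * S.

Lemma toeplitz_creation_linear : linear toeplitz_creation.
Proof.
have [[[lg _ _] _] _ _] := rel; have [[tl _] _ _ _] := itp_firstP BN.
by move=> a x y; rewrite /toeplitz_creation tl lg mulrDl cstar_scaleAl.
Qed.

Lemma toeplitz_creationM b f : toeplitz_creation b * g f = g (itp_first b f) * S.
Proof.
have [[[_ gM _] _] Sg _] := rel.
by rewrite -mulrA Sg mulrA -gM alphaE -itp_firstE.
Qed.

Lemma toeplitz_creation_inner x y :
  star (toeplitz_creation x) * toeplitz_creation y = psi (star x * y) *: (1 : D).
Proof.
have [[[lg gM gS] g1] _ gL] := rel; have [_ tM tS _] := itp_firstP BN.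
rewrite starM -gS tS star1 mulrA -(mulrA (star S)) -gM tM mulr1 -gL LE.
by rewrite (linear_scale lg) g1.
Qed.

Definition toeplitz_range := \sum_j toeplitz_creation (e j) * star (toeplitz_creation (e j)).

(** On [b \otimes f], [g (b \otimes f) * S] is the creation operator of [b] times [g f]. Expanding
    [b] in the basis shows that [toeplitz_range] fixes this operator. *)
Lemma toeplitz_range_redundancy : redundancy g S 1 toeplitz_range.
Proof.
have [[[lg gM gS] g1] _ _] := rel; split.
  move=> M [[_ M0 MD] MG]; apply: big_ind => // [x y Mx My|j _].
    by rewrite -[x]scale1r; apply: MD.
  apply: MG; exists (itp_first (e j) 1), (star (itp_first (e j) 1)).
  by rewrite gS starM !mulrA.
move=> h; apply: (tensor_linear_ext (itp_firstP BN) (f := fun h => g 1 * g h * S)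
  (g := fun h => toeplitz_range * g h * S)) => [a x y|a x y|b f].
- by rewrite lg mulrDr mulrDl -cstar_scaleAr -cstar_scaleAl.
- by rewrite lg mulrDr mulrDl -cstar_scaleAr -cstar_scaleAl.
rewrite g1 mul1r -mulrA -toeplitz_creationM mulrA; congr (_ * _).
rewrite mulr_suml {1}[b](he.2) (linear_bigsum toeplitz_creation_linear).
apply: eq_bigr => j _; rewrite -mulrA toeplitz_creation_inner -cstar_scaleAr mulr1.
by rewrite (linear_scale toeplitz_creation_linear).
Qed.

(** Inserting [toeplitz_range = 1] to the right of [g (b \otimes 1)] and of [g (1 \otimes f)]
    produces the two factors. *)
Lemma toeplitz_recursion b f : toeplitz_range = 1 ->
  g (itp_first b f) =
    left_rep e toeplitz_creation b * canonical_shift e toeplitz_creation (g f).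
Proof.
have [[[lg gM gS] g1] _ _] := rel; have [_ tM _ _] := itp_firstP BN => r1.
rewrite itp_firstE gM; congr (_ * _).
  rewrite -[LHS]mulr1 -r1 mulr_sumr; apply: eq_bigr => j _.
  by rewrite mulrA; congr (_ * _); rewrite mulrA -gM tM mulr1.
rewrite -[LHS]mulr1 -r1 mulr_sumr; apply: eq_bigr => j _.
rewrite mulrA; congr (_ * _).
by rewrite toeplitz_creationM mulrA -gM tM mulr1 mul1r.
Qed.

End Toeplitz.

Lemma representation_toeplitz_relations (D : cstarType R) (V : B -> D) (phi : BN -> D) :
  cuntz_representation psi e V -> unital_starhom phi ->
  (forall b f, phi (itp_first b f) = left_rep e V b * canonical_shift e V (phi f)) ->
  toeplitz_relations alpha L phi (V 1).
Proof.
move=> hV hphi phiE; have [lV VV _] := hV.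
have [[lphi phiM phiS] phi1] := hphi.
have [_ left1] := left_rep_starhom psi_state he hV.
split=> // [f|].
  by rewrite alphaE phiE left1 mul1r (shiftV he hV).
(* On [b \otimes f] the right side collapses to [(V 1)^* (V b) (phi f)], which is
   [psi b *: phi f]. *)
apply: (tensor_linear_ext (itp_firstP BN) (f := fun f => phi (L f))
  (g := fun f => star (V 1) * phi f * V 1)) => [a x y|a x y|b f].
- by rewrite linL lphi.
- by rewrite lphi mulrDr mulrDl -cstar_scaleAr -cstar_scaleAl.
rewrite LE (linear_scale lphi) phiE -!mulrA (shiftV he hV) (mulrA (left_rep e V b)).
rewrite (left_repV he hV) mulr1 mulrA VV star1 mul1r.
by rewrite -cstar_scaleAl mul1r.
Qed.

Lemma crossed_product_cuntz (E O : cstarType R) :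
  exel_crossed_product alpha L E -> cuntz_algebra n O -> star_isomorphic E O.
Proof.
move=> [T [i [S [q [[relT univT] hq q_surj q_ker]]]]] [s [hs univO]].
pose V := creation psi e s.
have hV : cuntz_representation psi e V := creation_representation psi_state he hs.
have [lV VV V1] := hV.
have [phi [hphi phiE]] := tensor_power_representation (BN := BN) psi_state he hV.
have relO := representation_toeplitz_relations hV hphi phiE.
have [theta [[htheta thetai thetaS] _]] := univT O phi (V 1) relO.
have [[ltheta thetaM _] theta1] := htheta.
have phi_creation x : phi (itp_first x 1) * V 1 = V x.
  rewrite phiE hphi.2 (shift_starhom he hV).2 mulr1 (left_repV he hV).
  by rewrite mulr1.
(* The kernel of [theta] is a closed ideal, so it suffices that it contains the differences of
   redundancies. These are tested on [V b = phi (b \otimes 1) * V 1], where the redundancy equation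
   applies. *)
have theta_ker x : q x = 0 -> theta x = 0.
  move/q_ker => /(_ [set x | theta x = 0]); apply; split.
    exact: starhom_ker_closed_ideal.
  move=> _ [f [k [[_ fk] ->]]] /=; rewrite (linear_sub ltheta) thetai.
  apply/eqP; rewrite subr_eq0; apply/eqP; apply: (rep_ext hV) => b.
  rewrite -phi_creation !mulrA -!thetai -thetaS -!thetaM.
  by rewrite fk.
have [F [hF Fq]] := starhom_factor hq q_surj htheta theta_ker.
pose g := q \o i.
have [ihom iS iL] := relT.
have hg : unital_starhom g := unital_starhom_comp hq ihom.
have [[lq qM qS] q1] := hq.
have relE : toeplitz_relations alpha L g (q S).
  by split=> // f; rewrite /g /= -?qS -!qM ?iS ?iL.
(* The redundancy [(1, toeplitz_range)] becomes an equality in the quotient. *)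
have rangeE : toeplitz_range (g := g) (S := q S) = 1.
  have : q (i 1 - toeplitz_range (g := i) (S := S)) = 0.
    apply/q_ker => I [_ ]; apply; exists 1, (toeplitz_range (g := i) (S := S)).
    by split=> //; exact: toeplitz_range_redundancy.
  rewrite (linear_sub lq) ihom.2 q1 => /eqP; rewrite subr_eq0 => /eqP ->.
  rewrite (linear_bigsum lq); apply: eq_bigr => j _.
  by rewrite /toeplitz_creation -qM -qS -qM.
pose W := toeplitz_creation (g := g) (S := q S).
have lW : linear W := toeplitz_creation_linear relE.
have hW : cuntz_relations (fun j => W (e j)).
  by split=> // j; rewrite toeplitz_creation_inner// he.1 eqxx scale1r.
have [G [[hG Gs] _]] := univO E _ hW.
have [[lG GM GS] G1] := hG.
have GV x : G (V x) = W x.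
  rewrite /V /creation (linear_bigsum lG) {2}[x](he.2) (linear_bigsum lW).
  by apply: eq_bigr => j _; rewrite (linear_scale lG) (linear_scale lW) Gs.
have FG : F \o G = id.
  have [h [_ uh]] := univO O s hs.
  rewrite -(uh (F \o G)) ?(uh id)//; split; first exact: unital_starhom_comp.
  move=> j; rewrite /= Gs /W /toeplitz_creation /g /= -qM Fq thetaM thetai thetaS.
  by rewrite phi_creation; exact: creation_basis.
(* Both maps obey the recursion determined by [W]: one through [phiE], the other because its range
   sum is 1. *)
have Gphi : G \o phi = g.
  apply: (itp_recursive_ext (p := left_rep e W) (r := canonical_shift e W)) => //.
  - exact: unital_starhom_comp.
  - move=> b f /=; rewrite phiE GM; congr (_ * _); rewrite (linear_bigsum lG);
      by apply: eq_bigr => j _; rewrite !GM GS !GV.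
  - by move=> b f; exact: toeplitz_recursion.
(* The uniqueness clause of the Toeplitz algebra applies only before the quotient, hence the
   composition with the surjection [q]. *)
have GF : (G \o F) \o q = q.
  have [h [_ uh]] := univT E g (q S) relE.
  rewrite -(uh ((G \o F) \o q)) ?(uh q)//; split.
  - by apply: unital_starhom_comp => //; exact: unital_starhom_comp.
  - by move=> f; rewrite /= Fq thetai; exact: (congr1 (fun h => h f) Gphi).
  - rewrite /= Fq thetaS GV /W /toeplitz_creation itp_first_starhom1.2 hg.2.
    by rewrite mul1r.
exists F; split=> //; exists G => [x|y]; last exact: (congr1 (fun h => h y) FG).
by have [z <-] := q_surj x; exact: (congr1 (fun h => h z) GF).
Qed.

End ExelSystem.

Theorem theorem4p3 (R : realType) (B : fdCstarType R) (psi : {scalar B})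
    (delta : R) (BN : infinite_tensor_power B) (alpha L : BN -> BN)
    (E O : cstarType R) :
  faithful_state psi -> 0 < delta -> delta_form psi delta ->
  exel_system alpha L ->
  (forall f : BN, alpha f = itp_first 1 f) ->
  (forall (f1 : B) (g : BN), L (itp_first f1 g) = psi f1 *: g) ->
  exel_crossed_product alpha L E ->
  cuntz_algebra (\dim {:B}) O ->
  star_isomorphic E O.
Proof.
move=> psi_state _ _ [_ [linL _ _]] alphaE LE hE.
have [n [e [<- he]]] := orthonormal_basis_exists psi_state.
exact: (crossed_product_cuntz psi_state he alphaE LE linL hE).
Qed.
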